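(* Let $\mathcal{E}=1-\frac{1+\log\log2}{\log2}$. There is an absolute constant $K>0$ such that for all integers $n,k$ with $1\le k\le n/2$, \[ i(n,k)\le\frac{K}{k^{\mathcal{E}}}. \]
   Context: $i(n,k)$ is the probability that a uniformly random permutation $\sigma$ in the symmetric group $\mathcal{S}_n$ on $[n]=\{1,\ldots,n\}$ fixes (setwise) some subset of $[n]$ of size $k$; equivalently, the probability that the cycle decomposition of $\sigma$ (including fixed points) contains disjoint cycles with lengths summing to $k$. Numerically $\mathcal{E}=0.08607\ldots$. *)

(* Defs.v *)
From mathcomp Require Import all_boot all_order all_algebra all_fingroup.
From mathcomp Require Import all_classical all_reals all_analysis.

Set Implicit Arguments.
Unset Strict Implicit.
Unset Printing Implicit Defensive.

Import Order.TTheory GRing.Theory Num.Theory.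

Local Open Scope ring_scope.

Definition fixes_kset (n k : nat) (s : 'S_n) : bool :=
  [exists A : {set 'I_n}, (#|A| == k) && (s @: A == A)].

Definition iprob (R : realType) (n k : nat) : R :=
  #|[set s : 'S_n | fixes_kset k s]|%:R / #|{: 'S_n}|%:R.

Definition EFG_exponent (R : realType) : R :=
  1 - (1 + ln (ln 2)) / ln 2.

(* Main.v *)
Require Import Defs.
From mathcomp Require Import all_boot all_order all_algebra all_fingroup.
From mathcomp Require Import all_classical all_reals all_analysis.
From mathcomp Require Import ring lra zify.
From mathcomp Require Import fintype finset.

(** Let X(s) be the number of cycles of length at most k of a permutation s,
and r = ln k / ln 2.  For a random s the variable X behaves like a Poisson
variable of mean ln k, so X >= r is a large deviation.  For X < r, the
probability of fixing some k-set is at most the expected number of fixed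
k-sets A, counted only for those s with X < r. A permutation fixing A is a
permutation of A together with one of its complement, and #|A|! (n - #|A|)!
times the number of k-sets is n!, so this expectation is the probability that
X(s1) + X(s2) < r for independent random s1 on k points and s2 on n - k >= k
points (cycles of s1 and s2 of length at most k): a small deviation of a
Poisson variable of mean 2 ln k.

Both events are handled by the exponential Chebyshev inequality, that is, by
1 <= z^(X - r) with z >= 1 when X >= r, and z <= 1 when X < r.  The optimal
parameters are z1 = 1 / ln 2 and z2 = 1 / (2 ln 2), and the threshold r is
the one for which both bounds equal k^(-E): this balance is where the exponent
E comes from.

What remains is the moment bound E[z^X] <= C k^(z - 1) on at least k points,
for 0 < z < 2 ([perm_weight_short_le]).  Write a_n for this expectation on n
points.  The cycle through a given point has uniformly distributed length,
which gives n a_n = sum_(1 <= j <= n) w_j a_(n-j) with w_j = z for j <= k and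
w_j = 1 for j > k ([perm_weightE]).  Subtracting consecutive instances leaves
  (n + 1) a_(n+1) = (n + z) a_n + [k <= n] (1 - z) a_(n-k).
For n <= k this makes a_n the product of the 1 + (z - 1) / j, at most
exp((z - 1) H_n); past k it keeps a_n within a constant factor of a_k. *)
Set Implicit Arguments.
Unset Strict Implicit.
Unset Printing Implicit Defensive.

Import Order.TTheory GRing.Theory Num.Theory.
Local Open Scope ring_scope.

(** * Permutations preserving a subset *)

Lemma imset_perm_astabs (T : finType) (B : {set T}) (s : {perm T}) :
  (s @: B == B) = (s \in 'N(B | 'P)%g).
Proof.
apply/eqP/astabsP => [sB x | sB] /=.
  by rewrite /aperm -{1}sB mem_imset //; exact: perm_inj.
apply/eqP; rewrite eqEcard card_imset ?leqnn ?andbT; last exact: perm_inj.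
by apply/subsetP => _ /imsetP[x xB ->]; rewrite -[s x]/(aperm x s) sB.
Qed.

Lemma perm_on_mulE (T : finType) (B C : {set T}) (t u : {perm T}) :
    [disjoint B & C] -> perm_on B t -> perm_on C u ->
  {in B, (t * u)%g =1 t} /\ {in C, (t * u)%g =1 u}.
Proof.
move=> dBC tB uC; split=> x xin; rewrite permM.
  by rewrite (out_perm uC) // (disjointFr dBC) // perm_closed.
by rewrite (out_perm tB) // (disjointFl dBC).
Qed.

Lemma disjoint_setD (T : finType) (A B : {set T}) : [disjoint B & A :\: B].
Proof. by rewrite -setI_eq0 setIDA setD_eq0 subsetIl. Qed.

(** The sum splits because Sym(B) x Sym(A :\: B) maps bijectively, by product,
to the permutations of A preserving B; the inverse is restriction. *)
Lemma sum_perm_stab (V : nmodType) (T : finType) (A B : {set T})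
    (F : {perm T} -> V) : B \subset A ->
  \sum_(s | perm_on A s && (s @: B == B)) F s =
  \sum_(t | perm_on B t) \sum_(u | perm_on (A :\: B) u) F (t * u)%g.
Proof.
move=> sBA; rewrite pair_big /=.
have dBC := disjoint_setD A B.
rewrite (reindex_onto (fun p : {perm T} * {perm T} => (p.1 * p.2)%g)
  (fun s => (restr_perm B s, restr_perm (A :\: B) s))) /=; last first.
  move=> s /andP[sA]; rewrite imset_perm_astabs => sB.
  have sC : s \in 'N(A :\: B | 'P)%g.
    apply/astabsP => x; rewrite !inE; move/astabsP: sB => -> /=.
    by rewrite /= /aperm perm_closed.
  have [mB mC] := perm_on_mulE dBC (restr_perm_on B s) (restr_perm_on (A :\: B) s).
  apply/permP => x; have [xB|xB] := boolP (x \in B).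
    by rewrite mB // restr_permE.
  have [xA|xA] := boolP (x \in A).
    by rewrite mC ?inE ?xB // restr_permE // inE xB.
  by rewrite permM !(out_perm (restr_perm_on _ _)) ?(out_perm sA) // inE (negPf xA) andbF.
apply: eq_bigl => -[t u] /=; apply/idP/idP.
  by case/andP=> _ /eqP[<- <-]; rewrite !restr_perm_on.
case/andP=> tB uC; have [mB mC] := perm_on_mulE dBC tB uC.
have stB : (t * u)%g \in 'N(B | 'P)%g.
  apply/astabsP => x; rewrite /= /aperm permM.
  have [xC|xC] := boolP (x \in A :\: B).
    have xB : x \in B = false by rewrite (disjointFl dBC).
    by rewrite (out_perm tB) ?xB // (disjointFl dBC) // perm_closed.
  have [xB|xB] := boolP (x \in B).
    have txB : t x \in B by rewrite perm_closed.
    by rewrite (out_perm uC) ?txB ?xB // (disjointFr dBC).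
  by rewrite (out_perm tB) ?(out_perm uC) // (negPf xB).
have stA : perm_on A (t * u)%g.
  apply: perm_onM; [exact: subset_trans tB _ | exact: subset_trans uC (subsetDl _ _)].
have stC : (t * u)%g \in 'N(A :\: B | 'P)%g.
  apply/astabsP => x; rewrite !inE; move/astabsP: stB => -> /=.
  by rewrite /= /aperm perm_closed.
rewrite stA imset_perm_astabs stB /= xpair_eqE; apply/andP; split; apply/eqP/permP=> x.
  have [xB|xB] := boolP (x \in B); first by rewrite restr_permE // mB.
  by rewrite (out_perm tB) ?(out_perm (restr_perm_on _ _)).
have [xC|xC] := boolP (x \in A :\: B); first by rewrite restr_permE // mC.
by rewrite (out_perm uC) ?(out_perm (restr_perm_on _ _)).
Qed.

Lemma eq_porbit_on (T : finType) (B : {set T}) (s t : {perm T}) :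
  perm_on B t -> {in B, s =1 t} -> {in B, forall y, porbit s y = porbit t y}.
Proof.
move=> tB st y yB.
have iterE i : (s ^+ i)%g y = (t ^+ i)%g y /\ (t ^+ i)%g y \in B.
  elim: i => [|i [IH1 IH2]]; first by rewrite !expg0 !perm1.
  by rewrite !expgSr !permM IH1 st // perm_closed.
by apply/setP => z; apply/porbitP/porbitP => -[i ->]; exists i;
  have [-> _] := iterE i.
Qed.

(** * Cycle-weighted sums over permutations *)

Section Weights.
Variables (R : comNzRingType) (T : finType).
Implicit Types (h : nat -> R) (A B : {set T}).

(** A product over points rather than over cycles: a cycle of length j then
weighs h j ^+ j, and the weight is multiplicative over disjoint supports with
no bookkeeping of the set of cycles. *)
Definition orbit_weight h A (s : {perm T}) : R :=
  \prod_(y in A) h #|porbit s y|.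

Definition perm_weight h A : R := \sum_(s | perm_on A s) orbit_weight h A s.

Definition full_cycles (x : T) B : nat :=
  #|[pred t : {perm T} | perm_on B t && (porbit t x == B)]|.

Lemma orbit_weightM h A B (t u : {perm T}) :
    B \subset A -> perm_on B t -> perm_on (A :\: B) u ->
  orbit_weight h A (t * u)%g = orbit_weight h B t * orbit_weight h (A :\: B) u.
Proof.
move=> sBA tB uC.
have dBC := disjoint_setD A B.
have [mB mC] := perm_on_mulE dBC tB uC.
rewrite /orbit_weight (big_setID B) /= (setIidPr sBA); congr (_ * _).
  by apply: eq_bigr => y yB; rewrite (eq_porbit_on tB mB).
by apply: eq_bigr => y yC; rewrite (eq_porbit_on uC mC).
Qed.

Lemma sum_weight_stab h A B : B \subset A ->
  \sum_(s | perm_on A s && (s @: B == B)) orbit_weight h A s =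
  perm_weight h B * perm_weight h (A :\: B).
Proof.
move=> sBA; rewrite sum_perm_stab // /perm_weight mulr_suml.
apply: eq_bigr => t tB; rewrite mulr_sumr.
by apply: eq_bigr => u uC; rewrite (orbit_weightM h sBA tB uC).
Qed.

Lemma sum_weight_porbit h A B x : x \in B -> B \subset A ->
  \sum_(s | perm_on A s && (porbit s x == B)) orbit_weight h A s =
  (full_cycles x B)%:R * h #|B| ^+ #|B| * perm_weight h (A :\: B).
Proof.
move=> xB sBA.
have dBC := disjoint_setD A B.
transitivity (\sum_(s | perm_on A s && (s @: B == B))
    (if porbit s x == B then orbit_weight h A s else 0)).
  rewrite -big_mkcondr /=; apply: eq_bigl => s; rewrite -andbA; congr (_ && _).
  case: eqP => [<-|]; last by rewrite andbF.
  rewrite andbT; symmetry; rewrite imset_perm_astabs; apply/astabsP => y.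
  by rewrite /= /aperm -!eq_porbit_mem; have := porbit_perm s 1 y; rewrite expg1 => ->.
rewrite sum_perm_stab //.
transitivity (\sum_(t | perm_on B t) if porbit t x == B
    then h #|B| ^+ #|B| * perm_weight h (A :\: B) else 0).
  apply: eq_bigr => t tB.
  have E u : perm_on (A :\: B) u -> porbit (t * u)%g x = porbit t x.
    by move=> uC; have [mB _] := perm_on_mulE dBC tB uC; exact: eq_porbit_on mB _ _.
  case: eqP => [tx|tx]; last by rewrite big1 // => u /E ->; case: eqP.
  rewrite mulr_sumr; apply: eq_bigr => u uC.
  rewrite E // tx eqxx (orbit_weightM h sBA tB uC); congr (_ * _).
  rewrite -prodr_const; apply: eq_bigr => y yB; congr h; rewrite -tx; congr #|pred_of_set _|.
  by apply/eqP; rewrite eq_porbit_mem tx.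
by rewrite -big_mkcondr sumr_const -mulrA mulr_natl.
Qed.

(** Removing the cycle B through x leaves an arbitrary permutation of A :\: B. *)
Lemma perm_weight_rec h A x : x \in A ->
  perm_weight h A = \sum_(B : {set T} | (x \in B) && (B \subset A))
     (full_cycles x B)%:R * h #|B| ^+ #|B| * perm_weight h (A :\: B).
Proof.
move=> xA; rewrite /perm_weight.
rewrite (partition_big (fun s => porbit s x)
  [pred B : {set T} | (x \in B) && (B \subset A)]) /=.
  by apply: eq_bigr => B /andP[xB sBA]; rewrite sum_weight_porbit.
move=> s sA; rewrite porbit_id; apply/subsetP => _ /porbitP[i ->].
by elim: i => [|i IH]; rewrite ?expg0 ?perm1 // expgSr permM perm_closed.
Qed.
End Weights.

Lemma sum_subsets_through (V : nmodType) (T : finType) (A : {set T}) x (G : nat -> V) :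
    x \in A ->
  \sum_(B : {set T} | (x \in B) && (B \subset A)) G #|B| =
  \sum_(j < #|A|) G j.+1 *+ 'C(#|A|.-1, j).
Proof.
move=> xA; have nA : #|A| = #|A :\ x|.+1 by rewrite (cardsD1 x A) xA.
transitivity (\sum_(B : {set T} | B \subset A :\ x) G #|B|.+1).
  rewrite (reindex_onto (fun B => x |: B) (fun B => B :\ x)) /=; last first.
    by move=> B /andP[xB _]; rewrite setD1K.
  apply: eq_big => B.
    rewrite setU11 /= subUset sub1set xA subsetD1 /=; congr (_ && _).
    apply/eqP/idP => [<-|xB]; first by rewrite !inE eqxx.
    by rewrite setU1K.
  case/andP => _ /eqP BE; rewrite cardsU1; suff -> : x \notin B by [].
  by rewrite -BE !inE eqxx.
rewrite nA /= (partition_big (fun B : {set T} => inord #|B| : 'I_#|A :\ x|.+1) xpredT) //=.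
apply: eq_bigr => j _; rewrite -cards_draws -sumr_const.
apply: eq_big => B.
  rewrite !inE; apply: andb_id2l => sB; rewrite -val_eqE /= inordK //.
  by rewrite ltnS subset_leq_card.
by case/andP=> sB /eqP <-; rewrite inordK // ltnS subset_leq_card.
Qed.

Lemma perm_weight1 (R : comNzRingType) (T : finType) (A : {set T}) :
  perm_weight (fun=> 1 : R) A = (#|A| `!)%:R.
Proof.
rewrite /perm_weight -card_perm -sumr_const.
by apply: eq_bigr => s _; rewrite /orbit_weight big1.
Qed.

(** Each term is n!: if there are (j-1)! cycles on j points, then the cycle
through a given point has every length equally often. *)
Lemma sum_binomial_fact (R : comNzRingType) n :
  \sum_(j < n.+1) ((j.+1.-1)`!%:R * (n.+1 - j.+1)`!%:R : R) *+ 'C(n, j) = (n.+1`!)%:R.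
Proof.
rewrite factS natrM mulr_natl -[n.+1 in RHS]card_ord -sumr_const.
apply: eq_bigr => j _; rewrite subSS -natrM -[_ *+ 'C(_, _)]mulr_natl -natrM.
by rewrite bin_fact // -ltnS.
Qed.

(** Counting all permutations of A by the cycle through x expresses #|A|! by the
numbers of full cycles on the subsets through x.  The values (j-1)! satisfy the
same identity, and by induction only the term for A itself can differ. *)
Lemma full_cyclesE (T : finType) (A : {set T}) x :
  x \in A -> full_cycles x A = (#|A|.-1)`!.
Proof.
have [m leAm] := ubnP #|A|; elim: m A leAm => // m IH A leAm xA.
have := perm_weight_rec (fun=> 1 : int) xA.
have := sum_subsets_through (fun j => (j.-1)`!%:R * (#|A| - j)`!%:R : int) xA.
have AA : (x \in A) && (A \subset A) by rewrite xA subxx.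
have nA : #|A| = #|A|.-1.+1 by rewrite prednK // (cardD1 x) xA.
have := sum_binomial_fact int #|A|.-1; rewrite -nA => ->.
rewrite perm_weight1 => <-.
rewrite !(bigD1 A AA) /= !expr1n subnn setDv !perm_weight1 cards0 !mulr1.
set S1 := \sum_(B | _) _; set S2 := \sum_(B | _) _.
have -> : S1 = S2.
  apply: eq_bigr => B /andP[/andP[xB sBA] nBA].
  have ltBA : (#|B| < #|A|)%N by rewrite proper_card // properEneq nBA.
  rewrite IH ?(leq_trans ltBA) // perm_weight1 cardsD (setIidPr sBA).
  by rewrite expr1n mulr1.
by move/addIr/eqP; rewrite eqr_nat => /eqP.
Qed.

(** So perm_weight h A depends on A through its size only, and a n is the mean
weight of a permutation of n points. *)
Lemma perm_weightE (R : comNzRingType) (h a : nat -> R) (T : finType) (A : {set T}) :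
    a 0%N = 1 ->
    (forall n, n.+1%:R * a n.+1 = \sum_(j < n.+1) h j.+1 ^+ j.+1 * a (n - j)%N) ->
  perm_weight h A = (#|A| `!)%:R * a #|A|.
Proof.
move=> a0 aS; have [m leAm] := ubnP #|A|; elim: m A leAm => // m IH A leAm.
have [->|[x xA]] := set_0Vmem A.
  rewrite cards0 a0 mulr1 /perm_weight (eq_bigl (pred1 1%g)) ?big_pred1_eq.
    by rewrite /orbit_weight big_set0.
  move=> s /=; apply/idP/eqP => [s0|->]; last exact: perm_on1.
  by apply/permP => y; rewrite perm1 (out_perm s0) ?inE.
rewrite (perm_weight_rec h xA).
pose G j := (j.-1)`!%:R * h j ^+ j * ((#|A| - j)`!%:R * a (#|A| - j)%N).
transitivity (\sum_(B : {set T} | (x \in B) && (B \subset A)) G #|B|).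
  apply: eq_bigr => B /andP[xB sBA] /=; rewrite full_cyclesE // IH.
    by rewrite cardsD (setIidPr sBA).
  rewrite cardsD (setIidPr sBA) (leq_trans _ (leAm : (#|A| <= m)%N)) // ltn_subrL.
  by rewrite !card_gt0; apply/andP; split; apply/set0Pn; exists x.
rewrite (sum_subsets_through G xA) /G.
have -> : #|A| = #|A|.-1.+1 by rewrite prednK // (cardD1 x) xA.
set n := #|A|.-1; rewrite factS natrM mulrAC aS mulr_suml.
apply: eq_bigr => j _; rewrite subSS -mulr_natr /= -(@bin_fact n j) -1?ltnS // !natrM; ring.
Qed.

(** * The mean weight when cycles of length at most k weigh z *)

(** The recursion for the means is a course-of-values one, so the whole history
is kept, latest value first. *)
Fixpoint cycle_mean_list (R : fieldType) (w : nat -> R) n : seq R :=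
  if n is m.+1 then
    let s := cycle_mean_list w m in
    (m.+1%:R^-1 * \sum_(j < m.+1) w j.+1 * s`_j) :: s
  else [:: 1].

Lemma cycle_mean_exists (R : numFieldType) (w : nat -> R) :
  exists2 a : nat -> R, a 0%N = 1 &
    forall n, n.+1%:R * a n.+1 = \sum_(j < n.+1) w j.+1 * a (n - j)%N.
Proof.
have nthE n j : (j <= n)%N -> (cycle_mean_list w n)`_j = (cycle_mean_list w (n - j))`_0.
  elim: n j => [|n IH] [|j] //= jn; exact: IH.
exists (fun n => (cycle_mean_list w n)`_0) => // n /=.
rewrite mulVKf ?pnatr_eq0 //; apply: eq_bigr => j _.
by rewrite nthE // -ltnS.
Qed.

Section Truncated.
Variables (R : realFieldType) (z : R) (k : nat) (a : nat -> R).
Hypothesis k0 : (0 < k)%N.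
Hypothesis aS : forall n, n.+1%:R * a n.+1 =
  \sum_(j < n.+1) (if (j.+1 <= k)%N then z else 1) * a (n - j)%N.

(** Consecutive instances of [aS] have the same weights except at one place:
w_(j+1) - w_j vanishes for j <> k and equals 1 - z for j = k. *)
Lemma truncated_mean_rec n :
  n.+1%:R * a n.+1 =
  (n%:R + z) * a n + (if (k <= n)%N then (1 - z) * a (n - k)%N else 0).
Proof.
rewrite aS big_ord_recl k0 subn0 mulrDl [RHS]addrAC [RHS]addrC; congr (_ + _).
case: n => [|n]; first by rewrite big_ord0 mul0r leqNgt k0 addr0.
under eq_bigr => j _ do rewrite lift0 subSS.
rewrite aS; have [kn|kn] := leqP k n.+1; last first.
  rewrite addr0; apply: eq_bigr => j _.
  by rewrite !(leq_trans _ kn) //; have := ltn_ord j; lia.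
have kE : (k.-1 < n.+1)%N by lia.
rewrite (bigD1 (Ordinal kE)) //= [in RHS](bigD1 (Ordinal kE)) //=.
have -> : (k.-1.+2 <= k)%N = false by lia.
have -> : (k.-1.+1 <= k)%N by lia.
have -> : (n.+1 - k = n - k.-1)%N by lia.
rewrite addrAC; congr (_ + _); first by ring.
apply: eq_bigr => j jk.
have -> : (j.+2 <= k)%N = (j.+1 <= k)%N; last by [].
have : (j : nat) <> k.-1 by move=> e; move/eqP: jk; apply; apply: val_inj.
lia.
Qed.

Lemma truncated_mean_sum : z * \sum_(i < k) a i = k%:R * a k.
Proof.
case: k k0 aS => // m _ aS'; rewrite aS' mulr_sumr [RHS](reindex_inj rev_ord_inj) /=.
apply: eq_bigr => j _; have jm := ltn_ord j.
have -> : (m.+1 - j.+1).+1%N = (m.+1 - j)%N by lia.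
rewrite leq_subr; congr (_ * a _); lia.
Qed.

Hypotheses (z0 : 0 < z) (a0 : a 0%N = 1).

Lemma truncated_mean_ge0 n : 0 <= a n.
Proof.
have [m] := ubnP n; elim: m n => // m IH [|n] nm; first by rewrite a0.
rewrite -(@pmulr_rge0 _ n.+1%:R) ?ltr0n // aS.
apply: sumr_ge0 => j _; apply: mulr_ge0; first by case: ifP => _ //; exact: ltW.
by apply: IH; lia.
Qed.

(** For n > 2k the recursion makes a_n an average of a_(n-1) and a_(n-1-k), both
of which have index at least k, so the bound propagates.  For k < n <= 2k the
extra terms (1 - z) a_i / n, i < k, add up to at most (1 - z) a_k / z since the
sum of these a_i is k a_k / z. *)
Lemma truncated_mean_le_z_le1 n : z <= 1 -> (k <= n)%N -> a n <= a k / z.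
Proof.
move=> z1.
have kR : 0 < k%:R :> R by rewrite ltr0n.
have start m : (m <= k)%N -> a (k + m) <= a k + (1 - z) / k%:R * \sum_(i < m) a i.
  elim: m => [|m IH] mk; first by rewrite addn0 big_ord0 mulr0 addr0.
  rewrite big_ord_recr /= mulrDr addrA.
  apply: le_trans (_ : a (k + m) + (1 - z) / k%:R * a m <= _); last first.
    by rewrite lerD2r IH // ltnW.
  have nR : 0 < (k + m).+1%:R :> R by rewrite ltr0n.
  rewrite addnS -(ler_pM2l nR) truncated_mean_rec leq_addr addKn mulrDr; apply: lerD.
    apply: ler_wpM2r; first exact: truncated_mean_ge0.
    by rewrite -natr1 lerD2l.
  rewrite !mulrA; apply: ler_wpM2r; first exact: truncated_mean_ge0.
  rewrite mulrAC ler_peMl ?subr_ge0 // ler_pdivlMr // mul1r ler_nat; lia.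
have half m : (m <= k)%N -> a (k + m) <= a k / z.
  move=> mk; apply: le_trans (start _ mk) _.
  have -> : a k / z = a k + (1 - z) / k%:R * \sum_(i < k) a i.
    have -> : \sum_(i < k) a i = k%:R * a k / z by rewrite -truncated_mean_sum mulrC mulKf ?gt_eqF.
    by field; rewrite !gt_eqF.
  rewrite lerD2l; apply: ler_wpM2l; first by rewrite divr_ge0 ?subr_ge0 // ltW.
  rewrite -!(big_mkord xpredT) (big_cat_nat (n := m) (p := k)) //= lerDl.
  by apply: sumr_ge0 => i _; exact: truncated_mean_ge0.
have [m] := ubnP n; elim: m n => // m IH n nm kn.
have [n2|n2] := leqP n (k + k); first by rewrite -(subnKC kn); apply: half; lia.
case: n nm kn n2 => [|n] nm kn n2; first lia.
have nR : 0 < n.+1%:R :> R by rewrite ltr0n.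
rewrite -(ler_pM2l nR) truncated_mean_rec ifT; last by lia.
have -> : n.+1%:R * (a k / z) = (n%:R + z) * (a k / z) + (1 - z) * (a k / z).
  by rewrite -natr1; ring.
apply: lerD; apply: ler_wpM2l; rewrite ?subr_ge0 ?addr_ge0 ?ler0n ?(ltW z0) //; apply: IH; lia.
Qed.

(** Here a is nondecreasing.  Summing n (a_n - a_(n-1)) = (z - 1) (a_(n-1) -
a_(n-1-k)) over k < n <= N telescopes on the right to at most (z - 1) k a_N,
while the left side is at least k (a_N - a_k). *)
Lemma truncated_mean_le_z_ge1 n : 1 <= z -> z < 2 -> (k <= n)%N -> a n <= a k / (2 - z).
Proof.
move=> z1 z2 /subnKC <-; move: (n - k)%N => {}n.
(* a_(n+1) - a_n is a nonnegative multiple of a_n - a_(n-k), or of a_n if n < k. *)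
have mono i j : (i <= j)%N -> a i <= a j.
  have [m] := ubnP j; elim: m i j => // m IH i [|j] jm; first by rewrite leqn0 => /eqP ->.
  rewrite leq_eqVlt => /predU1P[-> //|]; rewrite ltnS => ij.
  have nR : 0 < j.+1%:R :> R by rewrite ltr0n.
  apply: le_trans (IH i j _ ij) _ => //.
  rewrite -(ler_pM2l nR) truncated_mean_rec -natr1.
  case: leqP => kj; last by rewrite addr0 ler_wpM2r ?truncated_mean_ge0 // lerD2l.
  have : a (j - k)%N <= a j by apply: IH; lia.
  move=> /(ler_wpM2l (_ : 0 <= z - 1)); rewrite subr_ge0 => /(_ z1); lra.
have kR : 0 < k%:R :> R by rewrite ltr0n.
have tele m : k%:R * (a (k + m) - a k) <= (z - 1) * \sum_(i < k) a (m + i).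
  elim: m => [|m IH].
    rewrite addn0 subrr mulr0 mulr_ge0 ?subr_ge0 //.
    by apply: sumr_ge0 => i _; exact: truncated_mean_ge0.
  have -> : \sum_(i < k) a (m.+1 + i) = \sum_(i < k) a (m + i) + a (k + m) - a m.
    have E : \sum_(i < k.+1) a (m + i)%N = a m + \sum_(i < k) a (m.+1 + i)%N.
      rewrite big_ord_recl addn0; congr (_ + _).
      by apply: eq_bigr => i _; rewrite lift0 addSnnS.
    rewrite [(k + m)%N]addnC -[_ + a (m + k)%N](big_ord_recr k (fun i => a (m + i)%N)).
    by rewrite E addrC addKr.
  have step : k%:R * (a (k + m.+1) - a (k + m)) <= (z - 1) * (a (k + m) - a m).
    apply: le_trans (_ : (k + m).+1%:R * (a (k + m.+1) - a (k + m)) <= _).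
      apply: ler_wpM2r; first by rewrite subr_ge0 mono // leq_add2l.
      by rewrite ler_nat; lia.
    rewrite addnS mulrBr truncated_mean_rec leq_addr addKn -natr1; lra.
  lra.
have sumk : \sum_(i < k) a (n + i) <= k%:R * a (k + n).
  rewrite -[k in k%:R]card_ord mulr_natl -sumr_const; apply: ler_sum => i _.
  by apply: mono; rewrite addnC leq_add2r ltnW.
rewrite ler_pdivlMr ?subr_gt0 // -(ler_pM2l kR).
have := ler_wpM2l (_ : 0 <= z - 1) sumk; rewrite subr_ge0 => /(_ z1).
have := tele n; lra.
Qed.
End Truncated.

(** * Moments of the number of short cycles *)

Section Moments.
Variable R : realType.
Implicit Types (z : R) (k : nat).

Definition harmonic_sum k : R := \sum_(i < k) (i.+1%:R)^-1.

(** Both bounds on the harmonic sum come from ln (1 + x) <= x, which compares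
ln (j + 1) - ln j to 1 / j when x = 1 / j, and to 1 / (j + 1) when
x = - 1 / (j + 1).  Here the induction is on the stronger bound ln (k + 1). *)
Lemma ln_le_harmonic_sum k : (0 < k)%N -> ln (k%:R : R) <= harmonic_sum k.
Proof.
move=> k0; apply: le_trans (_ : ln (k.+1%:R : R) <= _).
  by rewrite ler_ln ?posrE ?ltr0n // ler_nat.
rewrite /harmonic_sum; elim: k {k0} => [|k IH]; first by rewrite big_ord0 ln1.
rewrite big_ord_recr /=.
have p0 : 0 < k.+1%:R :> R by rewrite ltr0n.
have -> : k.+2%:R = k.+1%:R * (1 + k.+1%:R^-1) :> R.
  by rewrite mulrDr mulr1 mulfV ?gt_eqF // natr1.
have q0 : 0 < 1 + k.+1%:R^-1 :> R by rewrite addr_gt0 // invr_gt0.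
rewrite lnM ?posrE // lerD // le_ln1Dx // (lt_trans (ltrN10 R)) // invr_gt0 //.
Qed.

Lemma harmonic_sum_le k : (0 < k)%N -> harmonic_sum k <= 1 + ln (k%:R : R).
Proof.
case: k => // k _; rewrite /harmonic_sum.
elim: k => [|k IH]; first by rewrite big_ord_recl big_ord0 ln1 invr1 addr0.
rewrite big_ord_recr /=.
have p0 : 0 < k.+1%:R :> R by rewrite ltr0n.
have p1 : 0 < k.+2%:R :> R by rewrite ltr0n.
have := @le_ln1Dx R (- k.+2%:R^-1).
rewrite ltrN2 invf_lt1 // ltr1n => /(_ isT).
have -> : 1 - k.+2%:R^-1 = k.+1%:R / k.+2%:R :> R.
  apply: (@mulIf _ k.+2%:R); rewrite ?gt_eqF //.
  by rewrite mulrBl mul1r mulVf ?divfK ?gt_eqF // -[k.+2%:R]natr1 addrK.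
rewrite ln_div ?posrE // -lerN2 opprK opprB => lnS.
by apply: le_trans (lerD IH lnS) _; rewrite -addrA subrKC.
Qed.

(** Up to k the recursion multiplies by 1 + (z - 1) / (n + 1) at each step. *)
Lemma truncated_mean_le_expR z k (a : nat -> R) : 0 < z -> (0 < k)%N -> a 0%N = 1 ->
    (forall n, n.+1%:R * a n.+1 =
      \sum_(j < n.+1) (if (j.+1 <= k)%N then z else 1) * a (n - j)%N) ->
  a k <= expR ((z - 1) * harmonic_sum k).
Proof.
move=> z0 k0 a0 aS.
suff H n : (n <= k)%N -> a n <= expR ((z - 1) * harmonic_sum n) by exact: H.
rewrite /harmonic_sum; elim: n => [|n IH] nk; first by rewrite big_ord0 mulr0 expR0 a0.
have p0 : 0 < n.+1%:R :> R by rewrite ltr0n.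
have -> : a n.+1 = (1 + (z - 1) / n.+1%:R) * a n.
  have := truncated_mean_rec k0 aS n; rewrite leqNgt nk /= addr0 => E.
  apply: (@mulfI _ n.+1%:R); first by rewrite gt_eqF.
  rewrite E mulrA mulrDr mulr1 mulrCA mulfV ?gt_eqF // mulr1 -natr1; ring.
rewrite big_ord_recr /= mulrDr expRD [leRHS]mulrC; apply: ler_pM.
- rewrite -(@pmulr_rge0 _ n.+1%:R) // mulrDr mulr1 mulrCA mulfV ?gt_eqF // mulr1.
  by rewrite -natr1 -addrA subrKC addr_ge0 ?ler0n ?ltW.
- exact: (truncated_mean_ge0 k0 aS z0 a0).
- exact: expR_ge1Dx.
- exact: IH (ltnW nk).
Qed.

(** The j points of a cycle of length j <= k share its weight z. *)
Definition short_weight z k (j : nat) : R :=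
  if (j <= k)%N then expR (ln z / j%:R) else 1.

Lemma short_weightX z k j : 0 < z ->
  short_weight z k j.+1 ^+ j.+1 = if (j.+1 <= k)%N then z else 1.
Proof.
move=> z0; rewrite /short_weight; case: ifP => _; last by rewrite expr1n.
by rewrite -expRM_natl mulrC divfK ?pnatr_eq0 // lnK.
Qed.

Lemma short_mean_exists z k : 0 < z -> exists a : nat -> R,
  [/\ a 0%N = 1,
      forall n, n.+1%:R * a n.+1 =
        \sum_(j < n.+1) (if (j.+1 <= k)%N then z else 1) * a (n - j)%N &
      forall (T : finType) (A : {set T}),
        perm_weight (short_weight z k) A = (#|A| `!)%:R * a #|A|].
Proof.
move=> z0.
have [a a0 aS] := cycle_mean_exists (fun j => short_weight z k j ^+ j).
exists a; split=> // [n | T A]; last exact: perm_weightE a0 aS.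
by rewrite aS; apply: eq_bigr => j _; rewrite short_weightX.
Qed.

(** E[z^X] <= C k^(z - 1).  The harmonic sum enters with the sign of z - 1, hence
its lower bound for z <= 1 and its upper bound for z >= 1. *)
Lemma perm_weight_short_le z : 0 < z -> z < 2 -> exists2 C : R, 0 < C &
  forall k (T : finType) (A : {set T}), (0 < k)%N -> (k <= #|A|)%N ->
    perm_weight (short_weight z k) A <=
    C * (#|A| `!)%:R * expR ((z - 1) * ln k%:R).
Proof.
move=> z0 z2; have [z1|/ltW z1] := leP z 1.
  exists z^-1; first by rewrite invr_gt0.
  move=> k T A k0 kA; have [a [a0 aS ->]] := short_mean_exists k z0.
  rewrite [z^-1 * _]mulrC -mulrA ler_wpM2l //.
  apply: le_trans (truncated_mean_le_z_le1 k0 aS z0 a0 z1 kA) _.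
  rewrite mulrC ler_wpM2l ?invr_ge0 ?(ltW z0) //.
  apply: le_trans (truncated_mean_le_expR z0 k0 a0 aS) _.
  by rewrite ler_expR ler_wnM2l ?subr_le0 // ln_le_harmonic_sum.
have c0 : 0 < (2 - z)^-1 by rewrite invr_gt0 subr_gt0.
exists (expR (z - 1) / (2 - z)); first by rewrite mulr_gt0 ?expR_gt0.
move=> k T A k0 kA; have [a [a0 aS ->]] := short_mean_exists k z0.
rewrite [_ / _ * _]mulrC -mulrA ler_wpM2l //.
apply: le_trans (truncated_mean_le_z_ge1 k0 aS z0 a0 z1 z2 kA) _.
rewrite mulrAC ler_wpM2r ?(ltW c0) //.
apply: le_trans (truncated_mean_le_expR z0 k0 a0 aS) _; rewrite -expRD ler_expR.
apply: le_trans (ler_wpM2l _ (harmonic_sum_le k0)) _; first by rewrite subr_ge0.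
by rewrite mulrDr mulr1.
Qed.

(** * The bound for the probability of fixing a k-set *)

(** The number of cycles of length at most k: the points of a cycle of length j
contribute 1 / j each. *)
Definition short_cycles (T : finType) k (s : {perm T}) : R :=
  \sum_(y in [set: T]) if (#|porbit s y| <= k)%N then #|porbit s y|%:R^-1 else 0.

Lemma orbit_weight_short (T : finType) z k (s : {perm T}) : 0 < z ->
  orbit_weight (short_weight z k) [set: T] s = expR (ln z * short_cycles k s).
Proof.
move=> z0; rewrite /short_cycles mulr_sumr expR_sum; apply: eq_bigr => y _.
by rewrite /short_weight; case: ifP; rewrite ?mulr0 ?expR0.
Qed.

(** The term of s in the first sum is z1^(X - r), which is at least 1 if X >= r.
If X < r and s fixes some A of size k, then the term of (A, s) in the second
sum is z2^(X - r) >= 1. *)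
Lemma card_fixes_kset_le n k (z1 z2 r : R) : 1 <= z1 -> 0 < z2 -> z2 <= 1 ->
  #|[set s : 'S_n | fixes_kset k s]|%:R <=
  expR (- (ln z1 * r)) * perm_weight (short_weight z1 k) [set: 'I_n] +
  expR (- (ln z2 * r)) * \sum_(A : {set 'I_n} | #|A| == k)
     (perm_weight (short_weight z2 k) A * perm_weight (short_weight z2 k) (~: A)).
Proof.
move=> z1_1 z2_0 z2_1.
have -> : perm_weight (short_weight z1 k) [set: 'I_n] =
    \sum_(s : 'S_n) expR (ln z1 * short_cycles k s).
  apply: eq_big => s; first by rewrite /perm_on; apply/subsetP => x; rewrite inE.
  by rewrite orbit_weight_short // (lt_le_trans ltr01).
have -> : \sum_(A : {set 'I_n} | #|A| == k)
     (perm_weight (short_weight z2 k) A * perm_weight (short_weight z2 k) (~: A)) =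
   \sum_(s : 'S_n) \sum_(A : {set 'I_n} | (#|A| == k) && (s @: A == A))
      expR (ln z2 * short_cycles k s).
  rewrite (exchange_big_dep (fun A : {set 'I_n} => #|A| == k)) /=; last first.
    by move=> s A _ /andP[].
  apply: eq_bigr => A Ak; rewrite -setTD -sum_weight_stab ?subsetT //.
  apply: eq_big => s.
    rewrite Ak /=; suff -> : perm_on [set: 'I_n] s by [].
    by rewrite /perm_on; apply/subsetP => x; rewrite inE.
  by move=> _; rewrite orbit_weight_short.
rewrite !mulr_sumr -big_split /= -sum1_card natr_sum big_mkcond /=.
apply: ler_sum => s _; rewrite inE -expRD [X in _ <= _ + X]mulr_sumr.
under eq_bigr => A _ do rewrite -expRD.
have sum_ge0 : 0 <= \sum_(A : {set 'I_n} | (#|A| == k) && (s @: A == A))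
    expR (- (ln z2 * r) + ln z2 * short_cycles k s).
  by apply: sumr_ge0 => A _; exact: expR_ge0.
case: ifP => [/existsP[A sA] | _]; last by rewrite addr_ge0 ?expR_ge0.
have [rX|Xr] := leP r (short_cycles k s).
  rewrite -[1%:R]addr0 lerD // -expR0 ler_expR addrC -mulrBr.
  by rewrite mulr_ge0 ?ln_ge0 ?subr_ge0.
rewrite (bigD1 A) //= addrCA -[1%:R]addr0 lerD //.
  rewrite -expR0 ler_expR addrC -mulrBr mulr_le0 ?ln_le0 //.
  by rewrite subr_le0 ltW.
rewrite addr_ge0 ?expR_ge0 //; apply: sumr_ge0 => B _; exact: expR_ge0.
Qed.

Lemma perm_weight_short_ge0 z k (T : finType) (A : {set T}) :
  0 <= perm_weight (short_weight z k) A.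
Proof.
apply: sumr_ge0 => s _; apply: prodr_ge0 => y _.
by rewrite /short_weight; case: ifP => // _; exact: expR_ge0.
Qed.

Lemma iprob_le_moments (z1 z2 : R) : 1 <= z1 -> z1 < 2 -> 0 < z2 -> z2 <= 1 ->
  exists2 K : R, 0 < K & forall n k, (0 < k)%N -> (2 * k <= n)%N ->
    forall r : R, iprob R n k <=
      K * (expR ((z1 - 1) * ln k%:R - ln z1 * r) +
           expR (2 * ((z2 - 1) * ln k%:R) - ln z2 * r)).
Proof.
move=> z1_1 z1_2 z2_0 z2_1; have z1_0 := lt_le_trans ltr01 z1_1.
have [C1 C1_0 W1] := perm_weight_short_le z1_0 z1_2.
have [C2 C2_0 W2] := perm_weight_short_le z2_0 (le_lt_trans z2_1 (ltr1n R 2)).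
exists (C1 + C2 ^+ 2); first by rewrite addr_gt0 // exprn_gt0.
move=> n k k0 kn r.
have le_kn : (k <= n)%N by lia.
have le_kC : (k <= n - k)%N by lia.
have card_n : #|{: 'S_n}| = n`! by rewrite card_Sn.
rewrite /iprob card_n ler_pdivrMr ?ltr0n ?fact_gt0 //.
apply: le_trans (card_fixes_kset_le n k r z1_1 z2_0 z2_1) _.
pose E1 := expR ((z1 - 1) * ln k%:R); pose E2 := expR ((z2 - 1) * ln k%:R).
have -> : expR (2 * ((z2 - 1) * ln k%:R) - ln z2 * r) = expR (- (ln z2 * r)) * E2 ^+ 2.
  by rewrite expRD mulrC expRM_natl.
have -> : expR ((z1 - 1) * ln k%:R - ln z1 * r) = expR (- (ln z1 * r)) * E1.
  by rewrite expRD mulrC.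
have p1 := expR_ge0 (- (ln z1 * r)); have p2 := expR_ge0 (- (ln z2 * r)).
have H1 : perm_weight (short_weight z1 k) [set: 'I_n] <= C1 * n`!%:R * E1.
  have := W1 k _ [set: 'I_n] k0; by rewrite cardsT card_ord; apply.
have H2 : \sum_(A : {set 'I_n} | #|A| == k)
     (perm_weight (short_weight z2 k) A * perm_weight (short_weight z2 k) (~: A)) <=
   C2 ^+ 2 * n`!%:R * E2 ^+ 2.
  (* The bound n! is spread over the k-sets, k! (n - k)! for each. *)
  have -> : C2 ^+ 2 * n`!%:R * E2 ^+ 2 =
      \sum_(A : {set 'I_n} | #|A| == k) (C2 * k`!%:R * E2) * (C2 * (n - k)`!%:R * E2).
    rewrite sumr_const.
    have -> : #|[pred A : {set 'I_n} | #|A| == k]| = 'C(n, k).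
      by rewrite -[n in RHS]card_ord -card_draws; apply: eq_card => A; rewrite !inE.
    rewrite -mulr_natr -(@bin_fact n k) ?natrM //; ring.
  apply: ler_sum => A /eqP Ak.
  have Ck : #|~: A| = (n - k)%N by rewrite -(addKn #|A| #|~: A|) cardsC card_ord Ak.
  have WA := W2 k _ A k0; have WC := W2 k _ (~: A) k0.
  rewrite Ak in WA; rewrite Ck in WC.
  apply: ler_pM; [exact: perm_weight_short_ge0 | exact: perm_weight_short_ge0
    | exact: WA | exact: WC].
apply: le_trans (lerD (ler_wpM2l p1 H1) (ler_wpM2l p2 H2)) _.
have f0 : 0 <= n`!%:R :> R by rewrite ler0n.
rewrite -subr_ge0.
have -> : forall x y, (C1 + C2 ^+ 2) * (x * E1 + y * E2 ^+ 2) * n`!%:R -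
   (x * (C1 * n`!%:R * E1) + y * (C2 ^+ 2 * n`!%:R * E2 ^+ 2)) =
   C1 * (y * E2 ^+ 2) * n`!%:R + C2 ^+ 2 * (x * E1) * n`!%:R by move=> x y; ring.
by rewrite addr_ge0 // !mulr_ge0 ?exprn_ge0 ?expR_ge0 ?ltW.
Qed.

(** These place 1 / ln 2 between 1 and 2, and so 1 / (2 ln 2) below 1, as the two
Chebyshev inequalities and the moment bound require. *)
Lemma ln2_bounds : 2^-1 < ln (2 : R) < 1.
Proof.
have two : expR (ln 2) = 2 :> R by rewrite lnK // posrE.
apply/andP; split; rewrite -ltr_expR two.
  have := @expR_gt1Dx R (- 2^-1); rewrite oppr_eq0 invr_eq0 pnatr_eq0 => /(_ isT).
  have -> : 1 - 2^-1 = 2^-1 :> R by lra.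
  by rewrite expRN ltf_pV2 // posrE ?expR_gt0.
by have := @expR_gt1Dx R 1; rewrite oner_eq0 => /(_ isT).
Qed.
End Moments.

Theorem theorem1p25 (R : realType) :
  exists K : R, 0 < K /\
    forall n k : nat, (1 <= k)%N -> (2 * k <= n)%N ->
      iprob R n k <= K / (k%:R `^ EFG_exponent R).
Proof.
have /andP[l0 l1] := ln2_bounds R; set l := ln (2 : R) in l0 l1.
have lp : 0 < l by apply: lt_trans l0; rewrite invr_gt0.
have lV1 : 1 <= l^-1 by rewrite invf_ge1 // ltW.
have lV2 : l^-1 < 2 by rewrite -[2]invrK ltf_pV2 // posrE ?invr_gt0.
have [||||K K0 bound] := @iprob_le_moments R l^-1 (l^-1 / 2); rewrite ?divr_gt0 ?invr_gt0 //.
  by rewrite ler_pdivrMr // mul1r ltW.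
(* Both exponential bounds turn out to equal k^(-E), hence the factor 2. *)
exists (K * 2); split; first by rewrite mulr_gt0.
move=> n k k1 kn; apply: le_trans (bound n k k1 kn (ln k%:R / l)) _.
rewrite -mulrA ler_wpM2l ?(ltW K0) //.
have lnl : ln l^-1 = - ln l by rewrite lnV // posrE.
have lnl2 : ln (l^-1 / 2) = - ln l - l by rewrite ln_div ?posrE ?invr_gt0 // lnl.
rewrite /powR pnatr_eq0 gtn_eqF // -expRN /EFG_exponent lnl lnl2 -/l.
have -> : (l^-1 - 1) * ln k%:R - - ln l * (ln k%:R / l) =
   - ((1 - (1 + ln l) / l) * ln k%:R) by field; rewrite gt_eqF.
have -> : 2 * ((l^-1 / 2 - 1) * ln k%:R) - (- ln l - l) * (ln k%:R / l) =
   - ((1 - (1 + ln l) / l) * ln k%:R) by field; rewrite gt_eqF.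
lra.
Qed.
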